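(* Let $r$ be an even positive integer and $k$ a positive integer. In the game King, the Sprague-Grundy value of the generalized staircase $[(kr)^r,((k-1)r)^r,\ldots,r^r]$ is $2$ if $k=1$, and $1$ otherwise.
   Context: A partition is a finite weakly decreasing sequence $\lambda=[\lambda_1,\ldots,\lambda_s]$ of positive integers (exponents denote repetition of parts; $[\,]$ is the empty partition). For $i,j\ge 0$, $\lambda[i,j]=[\lambda_{i+1}-j,\lambda_{i+2}-j,\ldots]$ with trailing nonpositive entries removed. King is the impartial game whose positions are nonempty partitions; from $\mu$ a player may move to $\mu[a,b]$ for any $(a,b)\in\{(0,1),(1,0),(1,1)\}$ with $\mu[a,b]\ne[\,]$. The Sprague-Grundy value of a position is the mex (least nonnegative integer not in the set) of the Sprague-Grundy values of the positions reachable in one move (so $0$ for terminal positions). *)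

(* Defs.v *)
From mathcomp Require Import all_boot.
From mathcomp Require Import zify.

Set Implicit Arguments.
Unset Strict Implicit.
Unset Printing Implicit Defensive.

Definition is_partition (mu : seq nat) : bool :=
  sorted geq mu && all (ltn 0) mu.

(* mu[i,j]: the truncated subtraction sends nonpositive entries to 0. When mu
   is weakly decreasing these entries are trailing, so filtering them out is
   the removal of the trailing nonpositive entries. *)
Definition subpart (mu : seq nat) (i j : nat) : seq nat :=
  [seq x <- [seq y - j | y <- drop i mu] | 0 < x].

Definition mex (s : seq nat) : nat :=
  find (fun n => n \notin s) (iota 0 (size s).+1).

Lemma mexP (s : seq nat) :
  mex s \notin s /\ forall m, m < mex s -> m \in s.
Proof.
have Hhas : has (fun n => n \notin s) (iota 0 (size s).+1).
  rewrite has_predC; apply/negP => /allP sub.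
  by have := uniq_leq_size (iota_uniq 0 (size s).+1) sub; rewrite size_iota ltnn.
have Hlt := Hhas; rewrite has_find size_iota in Hlt.
split; first by have := nth_find 0 Hhas; rewrite nth_iota.
move=> m lt_m; have := before_find 0 lt_m.
by rewrite nth_iota ?add0n ?(ltn_trans lt_m Hlt) // => /negbFE.
Qed.

Definition king_position (mu : seq nat) : bool :=
  is_partition mu && (mu != [::]).

Definition king_moves (mu : seq nat) : seq (seq nat) :=
  [seq nu <- [seq subpart mu ab.1 ab.2 | ab <- [:: (0, 1); (1, 0); (1, 1)]]
     | nu != [::]].

(* Recursion on a bound for the length of play; sumn mu is such a bound since
   every move from a position removes a cell. The recursive characterization
   of the Sprague-Grundy value is king_sgE. *)
Fixpoint king_sg_rec (n : nat) (mu : seq nat) : nat :=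
  if n is n'.+1 then mex [seq king_sg_rec n' nu | nu <- king_moves mu] else 0.

Definition king_sg (mu : seq nat) : nat := king_sg_rec (sumn mu) mu.

Lemma subpart_partition (mu : seq nat) (i j : nat) :
  is_partition mu -> is_partition (subpart mu i j).
Proof.
case/andP=> mu_sorted _; rewrite /is_partition filter_all andbT.
have geq_trans : transitive geq by move=> y x z /= xy yz; exact: leq_trans yz xy.
apply: sorted_filter => //; apply: (homo_sorted (e := geq)).
  by move=> x y /= le_yx; exact: leq_sub2r.
exact: drop_sorted.
Qed.

Lemma king_moves_position (mu nu : seq nat) :
  king_position mu -> nu \in king_moves mu -> king_position nu.
Proof.
case/andP=> mu_part _; rewrite mem_filter => /andP[nu_n0 /mapP[ab _ nuE]].
by rewrite /king_position nu_n0 nuE subpart_partition.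
Qed.

Lemma sumn_subpart (mu : seq nat) (j : nat) :
  sumn (subpart mu 0 j) <= sumn mu.
Proof.
rewrite /subpart drop0; elim: mu => //= x mu IH.
by case: ifP => /= _; lia.
Qed.

Lemma sumn_king_moves (mu nu : seq nat) :
  king_position mu -> nu \in king_moves mu -> sumn nu < sumn mu.
Proof.
case: mu => [|x mu] //; case/andP=> /andP[_ /= /andP[x_gt0 _]] _.
rewrite mem_filter => /andP[_ /mapP[ab ab_in ->]].
have H := sumn_subpart mu; rewrite /subpart !drop0 in H.
move: ab_in; rewrite !inE => /or3P[] /eqP-> /=; rewrite /subpart /= ?drop0.
- have := H 1; case: ifP => /= _; lia.
- have := H 0; lia.
- have := H 1; lia.
Qed.

Lemma king_sgE (mu : seq nat) :
  king_position mu -> king_sg mu = mex [seq king_sg nu | nu <- king_moves mu].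
Proof.
suff recE n : forall la, king_position la -> sumn la <= n ->
    king_sg_rec n la = mex [seq king_sg nu | nu <- king_moves la].
  by move=> mu_pos; apply: recE.
have [m] := ubnP n; elim: m n => // m IH [|n] lt_nm la la_pos.
  by case: la la_pos => [|x la] // /andP[/andP[_ /= /andP[x_gt0 _]] _]; lia.
move=> le_la /=; congr mex; apply/eq_in_map => nu nu_in.
have nu_pos := king_moves_position la_pos nu_in.
have lt_nu := sumn_king_moves la_pos nu_in.
by rewrite /king_sg !IH //; lia.
Qed.

(* [(kr)^r, ((k-1)r)^r, ..., r^r] *)
Definition staircase (r k : nat) : seq nat :=
  flatten [seq nseq r ((k - i) * r) | i <- iota 0 k].

Lemma staircaseS (r k : nat) :
  staircase r k.+1 = nseq r (k.+1 * r) ++ staircase r k.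
Proof.
by rewrite /staircase /= subn0 (iotaDl 1 0) -map_comp; congr (_ ++ flatten _).
Qed.

Lemma staircase_position (r k : nat) :
  0 < r -> 0 < k -> king_position (staircase r k).
Proof.
move=> r_gt0; case: k => // k _.
have bnd n : all (fun x => 0 < x <= n * r) (staircase r n).
  apply/allP => x /flattenP[s /mapP[i]]; rewrite mem_iota => /= lt_in ->.
  by rewrite mem_nseq => /andP[_ /eqP->]; nia.
apply/andP; split; last by rewrite staircaseS; case: r r_gt0 {bnd}.
apply/andP; split; last by apply: sub_all (bnd k.+1) => x /andP[].
have geq_trans : transitive geq by move=> y x z /= xy yz; exact: leq_trans yz xy.
rewrite sorted_pairwise //; elim: k.+1 => // n IH.
rewrite staircaseS pairwise_cat IH andbT; apply/andP; split.
  apply/allrelP => x y; rewrite mem_nseq => /andP[_ /eqP->].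
  by move=> /(allP (bnd n)) /=; nia.
elim: {1}r => //= m ->; rewrite andbT.
by apply/allP => y; rewrite mem_nseq => /andP[_ /eqP->] /=.
Qed.

(* Main.v *)
(* The Sprague-Grundy value of la[i,j] depends only on the cell (i,j) of the
   Young diagram of la, so it suffices to guess a function on the cells and to
   check the mex recursion. For the staircase with r even, cut the diagram into
   r x r blocks: the value at local coordinates (a,b) of a block depends on the
   parities of a and b, on their order, and on whether the distance d of the
   block to the outermost antidiagonal of blocks is 0, odd, or even positive. *)
Require Import Defs.
From mathcomp Require Import all_boot.
From mathcomp Require Import zify.

(** In a weakly decreasing sequence the rows emptied by the first truncation form a suffix, so
    filtering them out does not shift the rows counted by the second [drop]. *)
Lemma subpart_subpart (la : seq nat) (i j a b : nat) : sorted geq la ->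
  subpart (subpart la i j) a b = subpart la (i + a) (j + b).
Proof.
move=> la_sorted; rewrite /subpart [i + a]addnC -drop_drop.
have: sorted geq (drop i la) by exact: drop_sorted.
have geq_trans : transitive geq by move=> y x z /= xy yz; exact: leq_trans yz xy.
move: (drop i la) => {la_sorted}s.
elim: s a => [|x s IH] a s_sorted; first by case: a.
have := s_sorted; rewrite /= (path_sortedE geq_trans) => /andP[le_x s'].
rewrite subn_gt0; case: ltnP => [lt_jx|le_xj].
  by case: a => [|a] /=; [have := IH 0 s'; rewrite !drop0 subnDA => ->|exact: IH].
(* the filter leaves nothing: every later part is at most x <= j *)
have small y : y \in x :: s -> y <= j.
  by rewrite inE => /predU1P[->|/(allP le_x) /= le_yx] //; exact: leq_trans le_xj.
have none (t : seq nat) c : {subset t <= x :: s} ->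
    [seq z <- [seq y - (j + c) | y <- t] | 0 < z] = [::].
  move=> sub; rewrite -(filter_pred0 [seq y - (j + c) | y <- t]).
  by apply/eq_in_filter => z /mapP[y /sub/small le_yj ->] /=; lia.
rewrite none; last by move=> y /mem_drop.
have := @none s 0; rewrite addn0 => -> // y y_s; by rewrite inE y_s orbT.
Qed.

(** Row [i] is the longest remaining row and decides alone; the default [0] of [nth] covers [i] past
    the last row. *)
Lemma subpart_eq0 (la : seq nat) (i j : nat) : sorted geq la ->
  (subpart la i j == [::]) = (nth 0 la i <= j).
Proof.
move=> la_sorted; rewrite /subpart -[i in nth _ _ i]addn0 -nth_drop.
have: sorted geq (drop i la) by exact: drop_sorted.
have geq_trans : transitive geq by move=> y x z /= xy yz; exact: leq_trans yz xy.
case: (drop i la) => [|x s] //=; rewrite (path_sortedE geq_trans).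
move=> /andP[le_x _]; rewrite subn_gt0; case: ltnP => // le_xj.
rewrite -(filter_pred0 [seq y - j | y <- s]); apply/eqP/eq_in_filter.
by move=> z /mapP[y /(allP le_x) /= le_yx ->]; lia.
Qed.

Lemma king_sg_subpart (la : seq nat) (f : nat -> nat -> nat) :
    is_partition la ->
    (forall i j, j < nth 0 la i ->
       f i j = mex [seq f p.1 p.2 | p <- [:: (i, j.+1); (i.+1, j); (i.+1, j.+1)]
                                  & p.2 < nth 0 la p.1]) ->
  forall i j, j < nth 0 la i -> king_sg (subpart la i j) = f i j.
Proof.
move=> la_part fE i j; have [m] := ubnP (sumn (subpart la i j)).
have la_sorted : sorted geq la by case/andP: la_part.
elim: m i j => // m IH i j lt_m lt_j.
have pos : king_position (subpart la i j).
  by rewrite /king_position subpart_partition // subpart_eq0 // -ltnNge.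
have movesE : king_moves (subpart la i j) =
    [seq subpart la p.1 p.2 | p <- [:: (i, j.+1); (i.+1, j); (i.+1, j.+1)]
                            & p.2 < nth 0 la p.1].
  rewrite /king_moves /= !subpart_subpart // !addn0 !addn1 !subpart_eq0 //.
  by rewrite -!ltnNge; do 3!case: ifP => _ /=.
rewrite king_sgE // fE // movesE -map_comp; congr mex; apply/eq_in_map => p p_in.
have lt_p : p.2 < nth 0 la p.1 by move: p_in; rewrite mem_filter => /andP[].
apply: IH => //; rewrite -ltnS; apply: leq_trans lt_m; rewrite ltnS.
by apply: sumn_king_moves pos _; rewrite movesE; apply: map_f.
Qed.

Lemma nth_staircase (r k i : nat) : 0 < r ->
  nth 0 (staircase r k) i = (k - i %/ r) * r.
Proof.
move=> r_gt0; elim: k i => [|k IH] i; first by rewrite nth_nil.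
rewrite staircaseS nth_cat size_nseq nth_nseq; case: ltnP => [lt_ir|le_ri].
  by rewrite divn_small.
by rewrite IH -{2}(subnK le_ri) divnDr ?divnn ?r_gt0 // addn1 subSS.
Qed.

(** Value at a cell with exactly one odd local coordinate; [p] tells whether the odd coordinate is
    the larger one. *)
Definition side_sg (d : nat) (p : bool) : nat :=
  if p then if d == 0 then 1 else (odd d).+2 else (~~ odd d).+2.

Definition block_sg (d a b : nat) : nat :=
  match odd a, odd b with
  | true, true => 0
  | true, false => side_sg d (b < a)
  | false, true => side_sg d (a < b)
  | false, false => if d == 0 then 2 else 1
  end.

Definition staircase_sg (r k i j : nat) : nat :=
  block_sg (k - (i %/ r + j %/ r)).-1 (i %% r) (j %% r).

(** From a cell of mixed parity, the diagonal move makes the other coordinate odd and keeps their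
    order, so it flips [p]. The two side values are 1 and 3 when [d] is 0, otherwise 2 and 3; the
    even-even value is then 2, respectively 1. *)
Lemma block_sg_interior (d a b : nat) :
  block_sg d a b =
    mex [:: block_sg d a b.+1; block_sg d a.+1 b; block_sg d a.+1 b.+1].
Proof.
rewrite /block_sg /= !ltnS; case: (ltngtP a b) => [_|_|->];
  case: (odd b); try case: (odd a); rewrite //= /side_sg;
  by case: d => [|d] /=; try case: (odd d) => /=; do ?case: ifP.
Qed.

Lemma block_sg_bottom (d a b : nat) : odd a -> b < a ->
  block_sg d a b =
    mex (block_sg d a b.+1 ::
         if d is d'.+1 then [:: block_sg d' 0 b; block_sg d' 0 b.+1] else [::]).
Proof.
move=> a_odd lt_ba; rewrite /block_sg /side_sg /= a_odd lt_ba.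
case: (odd b) => /=; case: d => [|[|d]] /=; try case: (odd d) => /=;
  by do ?case: ifP.
Qed.

Lemma block_sg_right (d a b : nat) : odd b -> a < b ->
  block_sg d a b =
    mex (if d is d'.+1 then
           [:: block_sg d' a 0; block_sg d a.+1 b; block_sg d' a.+1 0]
         else [:: block_sg d a.+1 b]).
Proof.
move=> b_odd lt_ab; rewrite /block_sg /side_sg /= b_odd lt_ab.
case: (odd a) => /=; case: d => [|[|d]] /=; try case: (odd d) => /=;
  by do ?case: ifP.
Qed.

(** The value is 0 because every available move reaches a cell with an even coordinate. The diagonal
    move crosses two antidiagonals of blocks, hence [d'']. *)
Lemma block_sg_corner (d a : nat) : odd a ->
  block_sg d a a =
    mex (if d is d'.+1 then
           [:: block_sg d' a 0, block_sg d' 0 a &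
               if d' is d''.+1 then [:: block_sg d'' 0 0] else [::]]
         else [::]).
Proof.
move=> a_odd; have a_gt0 := odd_gt0 a_odd.
rewrite /block_sg /side_sg /= a_odd a_gt0.
by case: d => [|[|[|d]]] //=; case: (odd d).
Qed.

Lemma dvdnS_modn (r i : nat) : 0 < r -> (r %| i.+1) = (i %% r == r.-1).
Proof.
move=> r_gt0; have lt_i := ltn_pmod i r_gt0.
rewrite {1}(divn_eq i r) -addnS dvdn_addr ?dvdn_mull //.
apply/idP/eqP => [/dvdn_leq|->]; last by rewrite prednK.
by move=> /(_ isT); lia.
Qed.

Lemma staircase_sgE (r k i j : nat) : 0 < r -> ~~ odd r ->
    j < nth 0 (staircase r k) i ->
  staircase_sg r k i j =
    mex [seq staircase_sg r k p.1 p.2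
           | p <- [:: (i, j.+1); (i.+1, j); (i.+1, j.+1)]
           & p.2 < nth 0 (staircase r k) p.1].
Proof.
move=> r_gt0 r_even; rewrite /= !nth_staircase // -!ltn_divLR // => lt_j.
rewrite /staircase_sg.
have [d kE] : exists d, k = (i %/ r + j %/ r + d).+1.
  by exists (k - (i %/ r + j %/ r)).-1; move: (i %/ r) (j %/ r) lt_j => I J; lia.
(* Evenness of [r] makes the last row and column of each block odd. *)
have r1_odd : odd r.-1 by case: r r_gt0 r_even {lt_j kE} => //= r; rewrite negbK.
(* Written with [nseq], the three membership tests can be rewritten independently. *)
have -> (A B C : bool) (s := (i, j.+1)) (t := (i.+1, j)) (u := (i.+1, j.+1))
    (f : nat * nat -> nat) :
    [seq f p | p <- if A then s :: (if B then t :: (if C then [:: u] else [::])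
                                    else if C then [:: u] else [::])
               else if B then t :: (if C then [:: u] else [::])
                    else if C then [:: u] else [::]]
    = nseq A (f s) ++ nseq B (f t) ++ nseq C (f u).
  by case: A; case: B; case: C.
rewrite /= !ltn_subRL !modnS !divnS // !dvdnS_modn //.
have lt_a := ltn_pmod i r_gt0; have lt_b := ltn_pmod j r_gt0.
rewrite kE {kE lt_j}.
move: (i %/ r) (j %/ r) (i %% r) (j %% r) lt_a lt_b => I J a b lt_a lt_b.
(* Read as 0 or 1, [x] and [y] count the block borders crossed by a step down or right; a move is
   legal iff it crosses at most [d] of them, and [d] drops by that number. *)
set x := a == r.-1; set y := b == r.-1.
have -> : I + (y + J) < (I + J + d).+1 = (y <= d) by lia.
have -> : x + I + J < (I + J + d).+1 = (x <= d) by lia.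
have -> : x + I + (y + J) < (I + J + d).+1 = (x + y <= d) by lia.
have -> : ((I + J + d).+1 - (I + J)).-1 = d by lia.
have -> : ((I + J + d).+1 - (I + (y + J))).-1 = d - y by lia.
have -> : ((I + J + d).+1 - (x + I + J)).-1 = d - x by lia.
have -> : ((I + J + d).+1 - (x + I + (y + J))).-1 = d - (x + y) by lia.
rewrite {}/x {}/y; case: (a =P _) => aE; case: (b =P _) => bE /=.
- have -> : b = a by rewrite aE bE.
  rewrite block_sg_corner ?aE //; case: d => [|[|d]] //=.
  by rewrite subn1 subn2.
- rewrite subn0 block_sg_bottom ?aE //; last by lia.
  by case: d => [|d] //=; rewrite subn1.
- rewrite subn0 block_sg_right ?bE //; last by lia.
  by case: d => [|d] //=; rewrite subn1.
- by rewrite !subn0; exact: block_sg_interior.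
Qed.

Theorem lemma3p14 (r k : nat) (r_gt0 : 0 < r) (r_even : ~~ odd r) (k_gt0 : 0 < k) :
  king_sg (staircase r k) = if k == 1 then 2 else 1.
Proof.
have /andP[part _] := staircase_position r_gt0 k_gt0.
have -> : staircase r k = subpart (staircase r k) 0 0.
  case/andP: part => _ /all_filterP; rewrite /subpart drop0 => partE.
  by rewrite (eq_map (g := id)) ?map_id ?partE // => y; rewrite /= subn0.
rewrite (king_sg_subpart _ (staircase_sg r k)) //.
(* The origin is an even-even cell with [d] equal to [k.-1]. *)
- by rewrite /staircase_sg div0n mod0n; case: k k_gt0 {part} => [|[|k]].
- by move=> i j; exact: staircase_sgE.
- by rewrite nth_staircase // div0n subn0 muln_gt0 k_gt0.
Qed.
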